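(* Let $\Sigma=\Sigma_{g,1}$ be a surface of genus $g$ with one boundary component, $p$ a point on the boundary, and let $f\in\mathrm{Mod}(\Sigma)$ be a pseudo-Anosov mapping class fixing the boundary component pointwise, inducing a (fully irreducible) automorphism, also denoted $f$, of $\pi_1(\Sigma,p)\cong F_{2g}$, and such that $f_{ab}$ has finite order. Let $x\in F_{2g}$ have infinite $f$-orbit, and let $\delta$ be a (oriented) simple closed non-peripheral curve in $\Sigma$ with image $\widehat\delta\in H_1(\Sigma,\mathbb{R})$. For $i\ge1$ and $t\in[0,1]$ put $$h_i(\delta,t)=\widehat{i}\big(\lceil f^i(x)\rceil_{r_i(t)},\delta\big),\qquad r_i(t)=\big\lfloor |f^i(x)|\,t\big\rfloor,$$ let $R_i\subset\mathbb{R}$ be the range of $t\mapsto\frac1ih_i(\delta,t)$, and let $\sigma_i=\big(\frac1ih_i(\delta,\cdot)\big)_*\lambda$, where $\lambda$ is Lebesgue measure on $[0,1]$. Then: (1) In the Hausdorff topology, $\lim_{i\to\infty}R_i=\omega(\mathcal{S}_\infty f,\widehat\delta)$. (2) If $\sigma_\infty$ is the probability measure concentrated at the point $\omega(\overline{\mathfrak{D}_\infty f},\widehat\delta)$, then $\lim_{i\to\infty}\sigma_i=\sigma_\infty$ in the weak-* topology.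
   Context: Fix a free basis $a_1,\dots,a_{2g}$ of $\pi_1(\Sigma,p)\cong F_{2g}$; it gives an identification $H_1(\Sigma,\mathbb{R})\cong\mathbb{R}^{2g}$. $f_{ab}$ is the automorphism of $H_1(\Sigma,\mathbb{Z})\cong\mathbb{Z}^{2g}$ induced by $f$. For $w\in F_{2g}$, $|w|$ is its reduced word length and $\lceil w\rceil_j$ is the subword consisting of the first through $j$-th letters of the reduced word $w$ ($\lceil w\rceil_0=e$). $\widehat i$ is the oriented (algebraic) intersection form; it depends only on homology classes and is given by a symplectic form $\omega$ on $H_1(\Sigma,\mathbb{R})$: $\widehat i(\alpha,\beta)=\omega(\widehat\alpha,\widehat\beta)$. For a set $X\subset H_1(\Sigma,\mathbb{R})$, $\omega(X,\widehat\delta)=\{\omega(y,\widehat\delta):y\in X\}$. Homological shadow of $f$: let $\mathcal{R}_{2g}$ be the graph with one vertex and $2g$ oriented loops $a_1,\dots,a_{2g}$, each of length $1$. For $w\in F_{2g}$ let $p_w:[0,1]\to\mathcal{R}_{2g}$ be the constant speed path spelling the reduced word $w$, and let $\widetilde{\mathcal{S}}w:[0,1]\to\mathbb{R}^{2g}$ be the path starting at $0$ that moves with $p_w$ by $\pm e_j$ (linearly) whenever $p_w$ traverses $a_j^{\pm1}$. Put $\widetilde{\mathcal{S}}_kw=\frac1k\widetilde{\mathcal{S}}w$, $\mathcal{S}_kw=\mathrm{Im}\,\widetilde{\mathcal{S}}_kw$, $\mathfrak{D}_kw=(\widetilde{\mathcal{S}}_kw)_*\lambda$. For fully irreducible $f$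 with $f_{ab}$ of finite order, $\mathcal{S}_\infty f\subset\mathbb{R}^{2g}$ is the convex polytope which is the Hausdorff limit of $\mathcal{S}_kf^k(x)$ as $k\to\infty$, for any $x$ with infinite $f$-orbit, and $\overline{\mathfrak{D}_\infty f}\in\mathbb{R}^{2g}$ is the point such that $\mathfrak{D}_kf^k(x)$ weak-* converges to the point mass at $\overline{\mathfrak{D}_\infty f}$, for any such $x$ (both limits exist and are independent of $x$). *)

(* Defs.v *)
From HB Require Import structures.
From mathcomp Require Export all_boot all_order all_algebra.
From mathcomp Require Export all_classical all_reals all_analysis.
Export Order.TTheory GRing.Theory Num.Theory numFieldNormedType.Exports.

Set Implicit Arguments.
Unset Strict Implicit.
Unset Printing Implicit Defensive.

Local Open Scope classical_set_scope.
Local Open Scope ring_scope.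

(** ** The free group of rank [n], as the set of reduced words *)

Section FreeGroup.
Variable n : nat.

(* [(j, false)] is the generator a_j and [(j, true)] is its inverse. *)
Definition letter := ('I_n * bool)%type.

Definition inv_letter (l : letter) : letter := (l.1, ~~ l.2).

Definition reduced (w : seq letter) : bool :=
  sorted (fun l m : letter => m != inv_letter l) w.

Definition free_group := {w : seq letter | reduced w}.

Definition cons_reduce (l : letter) (w : seq letter) : seq letter :=
  if w is m :: w' then if m == inv_letter l then w' else l :: w else [:: l].

Definition reduce (w : seq letter) : seq letter := foldr cons_reduce [::] w.

Lemma reduce_reduced w : reduced (reduce w).
Proof.
elim: w => [//|l w /=]; rewrite /reduced; case: (reduce w) => [//|m v] /=.
by case: ifPn => [_ /path_sorted //|/= -> ->].
Qed.

Definition fg_of (w : seq letter) : free_group :=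
  exist (fun v : seq letter => reduced v) (reduce w) (reduce_reduced w).

Definition fg_gen (j : 'I_n) : free_group := fg_of [:: (j, false)].

Definition fg_mul (u v : free_group) : free_group := fg_of (val u ++ val v).

Definition fg_inv (u : free_group) : free_group :=
  fg_of (rev (map inv_letter (val u))).

(* The endomorphism of the free group sending a_j to [b j]. *)
Definition fg_ext (b : 'I_n -> free_group) (w : free_group) : free_group :=
  foldr (fun l : letter => fg_mul (if l.2 then fg_inv (b l.1) else b l.1))
    (fg_of [::]) (val w).

(* The subgroup generated by [b 0], ..., [b k.-1]. *)
Definition initial_factor (b : 'I_n -> free_group) (k : nat) :
    set free_group :=
  fg_ext b @` [set w | all (fun l : letter => (l.1 < k)%N) (val w)].

(* No positive power of [f] maps a nontrivial proper free factor to one of its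
   conjugates. Free factors are the subgroups generated by a part of some
   basis, and [b] is a basis iff [fg_ext b] is bijective. *)
Definition fully_irreducible (f : free_group -> free_group) : Prop :=
  forall (m : nat) (b : 'I_n -> free_group) (k : nat) (u : free_group),
    (0 < m)%N -> bijective (fg_ext b) -> (0 < k < n)%N ->
    iter m f @` initial_factor b k <>
      (fun w => fg_mul u (fg_mul w (fg_inv u))) @` initial_factor b k.

Definition infinite_orbit (f : free_group -> free_group) (x : free_group) :=
  infinite_set (range (fun i => iter i f x)).

Definition abel (K : nzRingType) (w : seq letter) : 'rV[K]_n :=
  \sum_(l <- w) (-1) ^+ l.2 *: delta_mx 0 l.1.

(* Row-vector convention: [abel (f w) = abel w *m ab_matrix f]. *)
Definition ab_matrix (f : free_group -> free_group) : 'M[int]_n :=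
  \matrix_(i, j) abel int (val (f (fg_gen i))) 0 j.

Definition finite_order_ab (f : free_group -> free_group) : Prop :=
  exists2 m : nat, (0 < m)%N & ab_matrix f ^+ m = 1.

End FreeGroup.

Arguments abel {n} K w.

(** ** Continuous maps, paths and homotopies *)

Definition homeo_between (X Y : topologicalType) (A : set X) (B : set Y)
    (h : X -> Y) : Prop :=
  [/\ set_bij A B h, {within A, continuous h} &
      exists k : Y -> X,
        {within B, continuous k} /\ forall x, A x -> k (h x) = x].

Section Surfaces.
Variables (R : realType) (T : topologicalType).
Implicit Types (gam del : R -> T) (U N : set T) (x p : T).

Definition closed_curve gam : Prop :=
  {within `[0, 1]%classic, continuous gam} /\ gam 0 = gam 1.

Definition simple_closed_curve gam : Prop :=
  closed_curve gam /\ {in `[0, 1[%R &, injective gam}.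

Definition loop_at p gam : Prop :=
  [/\ {within `[0, 1]%classic, continuous gam}, gam 0 = p & gam 1 = p].

Definition unit_square : set (R * R) := `[0, 1]%classic `*` `[0, 1]%classic.

(* Homotopy relative to the endpoints. *)
Definition path_homotopic gam del : Prop :=
  exists H : R * R -> T,
    [/\ {within unit_square, continuous H},
        (forall t, t \in `[0, 1]%R -> H (0, t) = gam t),
        (forall t, t \in `[0, 1]%R -> H (1, t) = del t) &
        (forall s, s \in `[0, 1]%R -> H (s, 0) = gam 0 /\ H (s, 1) = gam 1)].

Definition freely_homotopic gam del : Prop :=
  exists H : R * R -> T,
    [/\ {within unit_square, continuous H},
        (forall t, t \in `[0, 1]%R -> H (0, t) = gam t),
        (forall t, t \in `[0, 1]%R -> H (1, t) = del t) &
        (forall s, s \in `[0, 1]%R -> H (s, 0) = H (s, 1))].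

Definition concat_path gam del : R -> T :=
  fun t => if t <= 2^-1 then gam (2 * t) else del (2 * t - 1).

Definition rev_path gam : R -> T := fun t => gam (1 - t).

Definition word_path n p (a : 'I_n -> R -> T) (w : seq (letter n)) : R -> T :=
  foldr (fun l : letter n =>
           concat_path (if l.2 then rev_path (a l.1) else a l.1)) (cst p) w.

(* The loops [a j] freely generate the fundamental group based at [p]: the
   map from reduced words to homotopy classes of loops is a bijection. *)
Definition free_basis_pi1 n p (a : 'I_n -> R -> T) : Prop :=
  (forall j, loop_at p (a j)) /\
  forall gam, loop_at p gam ->
    exists! w : free_group n, path_homotopic gam (word_path p a (val w)).

(* [f] is the map induced by [phi] on the fundamental group, read in the free
   basis [a]; given [free_basis_pi1], it is determined by [phi]. *)
Definition induces_on_pi1 n p (a : 'I_n -> R -> T) (phi : T -> T)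
    (f : free_group n -> free_group n) : Prop :=
  forall w : free_group n,
    path_homotopic (phi \o word_path p a (val w)) (word_path p a (val (f w))).

(* [v] is the class of the closed curve [gam] in H_1(T, R), identified with
   R^n by means of the free basis [a]. *)
Definition homology_class n p (a : 'I_n -> R -> T) gam (v : 'rV[R]_n) : Prop :=
  exists w : free_group n,
    freely_homotopic gam (word_path p a (val w)) /\ v = abel R (val w).

(** ** Compact surfaces *)

Definition polar (r theta : R) : R * R := (r * cos theta, r * sin theta).

Definition disc (rho : R) : set (R * R) :=
  [set z | z.1 ^+ 2 + z.2 ^+ 2 < rho ^+ 2].

Definition chart := (set T * (T -> R * R))%type.

Definition plane_chart (c : chart) : Prop :=
  open c.1 /\ exists V : set (R * R), open V /\ homeo_between c.1 V c.2.

Definition half_plane_chart (c : chart) : Prop :=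
  open c.1 /\ exists V : set (R * R),
    open V /\ homeo_between c.1 (V `&` [set z | 0 <= z.2]) c.2.

Definition surf_int : set T :=
  [set x | exists c : chart, plane_chart c /\ c.1 x].

Definition surf_bd : set T := ~` surf_int.

Definition curve_image gam : set T := gam @` `[0, 1]%classic.

Definition nonseparating_system (m : nat) : Prop :=
  exists c : 'I_m -> R -> T,
    [/\ forall i, simple_closed_curve (c i) /\ curve_image (c i) `<=` surf_int,
        forall i j, i != j -> curve_image (c i) `&` curve_image (c j) = set0 &
        connected (~` \bigcup_i curve_image (c i))].

Definition has_genus (g : nat) : Prop :=
  nonseparating_system g /\ ~ nonseparating_system g.+1.

(* A compact connected topological surface of genus [g] whose boundary has
   exactly one connected component. *)
Definition compact_surface_g1 (g : nat) : Prop :=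
  [/\ [/\ hausdorff_space T, compact [set: T] & connected [set: T]],
      forall x, exists c : chart, half_plane_chart c /\ c.1 x,
      has_genus g, surf_bd !=set0 & connected surf_bd].

(** ** Orientations *)

(* [v] turns exactly once, counterclockwise, around the origin. *)
Definition winds_once (v : R -> R * R) : Prop :=
  exists rho theta : R -> R,
    [/\ {within `[0, 1]%classic, continuous theta}, theta 1 = theta 0 + 1 &
        forall u, u \in `[0, 1]%R ->
          0 < rho u /\ v u = polar (rho u) (2 * pi * theta u)].

(* The change of charts from [c] to [d] has local degree 1 at [x]: it maps a
   small counterclockwise circle around [c x] to a curve turning once
   counterclockwise around [d x]. *)
Definition co_oriented (c d : chart) x : Prop :=
  exists (r : R) (gam : R -> T),
    [/\ 0 < r,
        forall z : R * R,
          (z.1 - (c.2 x).1) ^+ 2 + (z.2 - (c.2 x).2) ^+ 2 <= r ^+ 2 ->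
          (c.2 @` (c.1 `&` d.1)) z,
        forall u, (c.1 `&` d.1) (gam u) /\
          c.2 (gam u) = c.2 x + polar r (2 * pi * u) &
        winds_once (fun u => d.2 (gam u) - d.2 x)].

Definition positive_chart (O : set chart) (c : chart) : Prop :=
  plane_chart c /\
  forall d x, O d -> c.1 x -> d.1 x -> co_oriented c d x.

(* An orientation is given on the interior by an oriented atlas [O]. *)
Definition oriented_atlas (O : set chart) : Prop :=
  (forall c, O c -> positive_chart O c) /\
  (forall x, surf_int x -> exists2 c, O c & c.1 x).

(* Homeomorphisms representing elements of Mod: orientation preserving and
   fixing the boundary pointwise. *)
Definition mod_homeo (O : set chart) (phi : T -> T) : Prop :=
  [/\ homeo_between [set: T] [set: T] phi,
      forall x, surf_bd x -> phi x = x &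
      forall c, O c -> positive_chart O (phi @^-1` c.1, c.2 \o phi)].

(** ** Curves and algebraic intersection *)

Definition nonperipheral gam : Prop :=
  forall del, simple_closed_curve del -> curve_image del = surf_bd ->
    ~ freely_homotopic gam del.

(* The 1-periodic extension of a closed curve. *)
Definition wrap gam : R -> T := fun t => gam (t - (Num.floor t)%:~R).

(* [gam] at time [s] crosses [del] at time [t] transversally: some positive
   chart maps them to the oriented horizontal axis and to the vertical axis.
   The crossing is positive, [neg = false], when [del] goes upwards. *)
Definition crossing (O : set chart) gam del (s t : R) (neg : bool) : Prop :=
  exists c : chart, exists2 eta : R,
    positive_chart O c /\ 0 < eta &
    forall u, `|u| < eta ->
      [/\ c.1 (wrap gam (s + u)), c.1 (wrap del (t + u)),
          c.2 (wrap gam (s + u)) = (u, 0) &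
          c.2 (wrap del (t + u)) = (0, (-1) ^+ neg * u)].

(* [n] is the signed number of crossings of some transverse representatives
   of the free homotopy classes of [gam] and [del]. *)
Definition crossing_number (O : set chart) gam del (n : int) : Prop :=
  exists (gam' del' : R -> T) (l : seq ((R * R) * bool)),
    [/\ freely_homotopic gam gam' /\ freely_homotopic del del',
        uniq (map fst l),
        forall s t, (s, t) \in map fst l <->
          [/\ s \in `[0, 1[%R, t \in `[0, 1[%R & gam' s = del' t],
        forall e, e \in l -> crossing O gam' del' e.1.1 e.1.2 e.2 &
        n = \sum_(e <- l) (-1) ^+ e.2].

Definition alg_int (O : set chart) gam del : int :=
  xget 0 [set n | crossing_number O gam del n].

(** ** Pseudo-Anosov mapping classes *)

(* Near [x], [w = (+- lam * z.1 + const, +- mu * z.2 + const)]. *)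
Definition affine_near (lam mu : R) x (z w : T -> R * R) : Prop :=
  exists (e1 e2 : bool) (c1 c2 : R), \forall y \near x,
    w y = ((-1) ^+ e1 * (lam * (z y).1) + c1,
           (-1) ^+ e2 * (mu * (z y).2) + c2).

(* Near [x], a coordinate of the atlas [A] is a branch of [c ^ (k / 2)], up to
   signs and translations. *)
Definition prong_coordinate (A : set chart) (k : nat) (c : T -> R * R) x :
    Prop :=
  exists (z : chart) (rho theta : T -> R),
    [/\ A z, z.1 x,
        \forall y \near x, {for y, continuous theta},
        \forall y \near x, 0 < rho y /\ c y = polar (rho y) (theta y) &
        affine_near 1 1 x
          (fun y => polar (rho y `^ (k%:R / 2)) (k%:R / 2 * theta y)) z.2].

Definition prong_point (A : set chart) (k : nat) x : Prop :=
  exists N (c : T -> R * R) (rho : R),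
    [/\ open N /\ N `<=` surf_int, N x /\ c x = 0, 0 < rho,
        homeo_between N (disc rho) c &
        forall y, N y -> y <> x -> prong_coordinate A k c y].

(* The boundary component is seen as a puncture of the interior. *)
Definition prong_boundary (A : set chart) (k : nat) : Prop :=
  exists N (c : T -> R * R) (rho : R),
    [/\ open N /\ surf_bd `<=` N, 0 < rho,
        homeo_between (N `&` surf_int) (disc rho `\ 0) c,
        forall eps : R, 0 < eps -> exists N', [/\ open N', surf_bd `<=` N' &
          forall y, (N' `&` surf_int) y -> (N `&` surf_int) y ->
            disc eps (c y)] &
        forall y, (N `&` surf_int) y -> prong_coordinate A k c y].

(* A pair of transverse measured foliations of the interior, given by an atlas
   of natural charts on the complement of the singularities: in a chart [z],
   the leaves of the two foliations are the horizontal and vertical segments,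
   and their transverse measures are |dz.2| and |dz.1|. Singularities have
   k >= 3 prongs, and k >= 1 prongs at the puncture. *)
Definition transverse_foliations (A : set chart) : Prop :=
  [/\ forall z, A z -> plane_chart z,
      forall z w x, A z -> A w -> z.1 x -> w.1 x ->
        affine_near 1 1 x z.2 w.2,
      forall x, surf_int x ->
        (exists2 z, A z & z.1 x) \/
        (exists2 k : nat, (3 <= k)%N & prong_point A k x) &
      exists2 k : nat, (1 <= k)%N & prong_boundary A k].

Definition isotopic_on (I : set T) (phi psi : T -> T) : Prop :=
  exists H : R * T -> T,
    [/\ {within `[0, 1]%classic `*` I, continuous H},
        forall x, I x -> H (0, x) = phi x,
        forall x, I x -> H (1, x) = psi x &
        forall s, s \in `[0, 1]%R -> homeo_between I I (fun x => H (s, x))].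

(* On the interior, [phi] is isotopic to a homeomorphism [psi] which stretches
   the measure of one foliation by [lam > 1] and that of the other one by
   [lam^-1]. *)
Definition pseudo_anosov (phi : T -> T) : Prop :=
  exists (A : set chart) (psi : T -> T) (lam : R),
    [/\ transverse_foliations A, 1 < lam,
        homeo_between surf_int surf_int psi, isotopic_on surf_int phi psi &
        forall z x, A z -> z.1 x ->
          exists w : chart, [/\ A w, w.1 (psi x) &
            affine_near lam lam^-1 x z.2 (w.2 \o psi)]].

End Surfaces.

Arguments surf_int R T _ : clear implicits.
Arguments surf_bd R T _ : clear implicits.
Arguments compact_surface_g1 R T g : clear implicits.
Arguments pseudo_anosov R {T} phi.

(** ** Hausdorff and weak-* convergence *)

Section Convergence.
Variables (R : realType) (V : normedModType R).

Definition hausdorff_cvg (X_ : nat -> set V) (X : set V) : Prop :=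
  forall eps : R, 0 < eps -> \forall k \near \oo,
    (forall y, X_ k y -> exists2 z, X z & `|y - z| < eps) /\
    (forall z, X z -> exists2 y, X_ k y & `|y - z| < eps).

Definition borel := g_sigma_algebraType (@open V).

Definition weak_star_cvg (mu_ : nat -> set borel -> \bar R)
    (mu : set borel -> \bar R) : Prop :=
  forall h : V -> R, continuous h -> (exists M, forall y, `|h y| <= M) ->
    (\int[mu_ k]_(y in [set: borel]) (h y)%:E)%E @[k --> \oo] -->
    (\int[mu]_(y in [set: borel]) (h y)%:E)%E.

(* The push-forward by [c] of the Lebesgue measure of [0, 1]. *)
Definition push01 (c : R -> V) : set borel -> \bar R :=
  pushforward (T2 := borel)
    (mrestr lebesgue_measure (measurable_itv `[0 : R, 1])) c.

Definition convex_polytope (X : set V) : Prop :=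
  exists (m : nat) (v : 'I_m.+1 -> V),
    X = [set y | exists c : 'I_m.+1 -> R,
      [/\ forall i, 0 <= c i, \sum_i c i = 1 & y = \sum_i c i *: v i]].

End Convergence.

(** ** Homological shadows *)

Section Shadow.
Variables (R : realType) (n : nat).

(* The constant speed path from 0 which follows the letters of [w]. *)
Definition shadow_path (w : seq (letter n)) (t : R) : 'rV[R]_n :=
  let s := (size w)%:R * t in
  let m := Num.truncn s in
  abel R (take m w) + (s - m%:R) *: abel R (take 1 (drop m w)).

Definition shadow_path_at (k : nat) (w : seq (letter n)) (t : R) : 'rV[R]_n :=
  k%:R^-1 *: shadow_path w t.

Definition shadow (k : nat) (w : seq (letter n)) : set 'rV[R]_n :=
  shadow_path_at k w @` `[0, 1]%classic.

Definition is_limit_shadow (f : free_group n -> free_group n)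
    (S : set 'rV[R]_n) : Prop :=
  convex_polytope S /\
  forall x, infinite_orbit f x ->
    hausdorff_cvg (fun k => shadow k (val (iter k f x))) S.

Definition is_limit_mean (f : free_group n -> free_group n)
    (D : 'rV[R]_n) : Prop :=
  forall x, infinite_orbit f x ->
    weak_star_cvg (fun k => push01 (shadow_path_at k (val (iter k f x))))
      (dirac (D : borel _)).

(* The bilinear form with Gram matrix [J]. *)
Definition bilin (J : 'M[R]_n) (u v : 'rV[R]_n) : R := (u *m J *m v^T) 0 0.

Definition symplectic (J : 'M[R]_n) : Prop := J^T = - J /\ J \in unitmx.

End Shadow.

(** ** Intersections along the orbit of a word *)

Section Intersections.
Variables (R : realType) (T : topologicalType) (n : nat).
Variables (O : set (chart R T)) (p : T) (a : 'I_n -> R -> T).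

(* [J] represents the algebraic intersection number of closed curves. *)
Definition represents_alg_int (J : 'M[R]_n) : Prop :=
  forall (gam del : R -> T) (u v : 'rV[R]_n),
    homology_class p a gam u -> homology_class p a del v ->
    (alg_int O gam del)%:~R = bilin J u v.

Definition prefix_int (f : free_group n -> free_group n) (x : free_group n)
    (delta : R -> T) (i : nat) (t : R) : R :=
  let w := val (iter i f x) in
  (alg_int O
     (word_path p a (take (Num.truncn ((size w)%:R * t)) w)) delta)%:~R.

End Intersections.

(* Main.v *)
Require Import Defs.
From mathcomp Require Import measurable_realfun ring lra.

Set Implicit Arguments.
Unset Strict Implicit.
Unset Printing Implicit Defensive.

(** Algebraic intersection with [delta] is the linear functional
    L = omega(-, dhat) applied to homology classes, and a prefix of a reduced
    word is a reduced word whose loop has the abelianisation of the prefix as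
    its class. So [prefix_int] at time [t] is L of the last integral point
    passed by the shadow path, which is within one letter of its position:
    after division by [i], (1/i) h_i and L o (shadow path of f^i x) differ
    uniformly by O(1/i). Both kinds of limit are carried along by the uniformly
    continuous map L and are insensitive to uniformly small perturbations. *)

Local Open Scope classical_set_scope.
Local Open Scope ring_scope.

(** * Integrals against push-forwards of Lebesgue measure on [0, 1] *)

Section Push.
Variable R : realType.

Definition leb01 : {measure set (measurableTypeR R) -> \bar R} :=
  mrestr lebesgue_measure (measurable_itv `[0 : R, 1]).

Lemma leb01T : leb01 setT = 1%E.
Proof. by rewrite /leb01 /= /mrestr setTI lebesgue_measure_itv /= lte01 oppr0 adde0. Qed.

Lemma leb01_integrable (h : R -> R) :
  measurable_fun (setT : set (measurableTypeR R)) h ->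
  (exists M, forall t, `|h t| <= M) -> leb01.-integrable setT (EFin \o h).
Proof.
move=> mh [M hM]; apply: measurable_bounded_integrable => //.
  by rewrite leb01T ltry.
by exists M; split; [exact: num_real|move=> x /ltW Mx t _; exact: le_trans (hM t) Mx].
Qed.

(* [push01 c] only sees [c] on [0, 1], whereas integrals against it range over
   the whole line: precomposing with [clamp01] turns bounds valid on [0, 1] into
   bounds valid everywhere. *)
Definition clamp01 (t : R) : R := Num.max 0 (Num.min 1 t).

Lemma clamp01_itv t : 0 <= clamp01 t <= 1.
Proof. by rewrite /clamp01 le_max lexx ge_max ler01 ge_min lexx. Qed.

Lemma clamp01_id t : 0 <= t <= 1 -> clamp01 t = t.
Proof. by move=> /andP[t0 t1]; rewrite /clamp01 min_r // max_r. Qed.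

Lemma measurable_clamp01 : measurable_fun (setT : set (measurableTypeR R)) clamp01.
Proof.
apply: measurable_maxr; first exact: measurable_cst.
by apply: measurable_minr; [exact: measurable_cst|exact: measurable_id].
Qed.

(** For [0 <= s] the map [t |-> truncn (s * t)] is nondecreasing, so its fibres are intervals. *)
Lemma measurable_fiber_truncn (s : R) (m : nat) : 0 <= s ->
  measurable [set t : measurableTypeR R | Num.truncn (s * t) = m].
Proof.
move=> s0; apply: is_interval_measurable => t u /= tm um v /andP[tv vu].
apply/eqP; rewrite eqn_leq -{1}um -tm.
by rewrite !le_truncn ?ler_wpM2l.
Qed.

Variable V : normedModType R.

Lemma push01_clamp (c : R -> V) : push01 c = push01 (c \o clamp01).
Proof.
apply/funext => A; rewrite /push01 /pushforward /mrestr; congr lebesgue_measure.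
by apply/seteqP; split=> t [] /= cA; rewrite in_itv /= => t01; split => //;
  move: cA; rewrite clamp01_id.
Qed.

(** Serves functions that follow a different continuous formula on each fibre of [truncn]: the
    preimage of an open set is a countable union of measurable pieces, and open sets generate
    [borel V]. *)
Lemma borel_measurable_piecewise (idx : R -> nat) (G : nat -> R -> V) :
  (forall m, measurable [set t : measurableTypeR R | idx t = m]) ->
  (forall m, continuous (G m)) ->
  measurable_fun (setT : set (measurableTypeR R))
    ((fun t => G (idx t) t) : R -> borel V).
Proof.
move=> midx cG; apply: (@measurability _ _ _ (borel V) setT _ (@open V)) => //.
move=> _ [U oU <-]; rewrite setTI.
rewrite (_ : _ @^-1` _ = \bigcup_m ([set t | idx t = m] `&` G m @^-1` U)).
  apply: bigcupT_measurable => m; apply: measurableI => //.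
  by apply: open_measurable; move/continuousP: (cG m); apply.
apply/seteqP; split => t /= => [Ut|[m _ [/= <-]] //].
by exists (idx t).
Qed.

Lemma continuous_borel_measurable (h : V -> R) :
  continuous h -> measurable_fun (setT : set (borel V)) h.
Proof.
move=> /continuousP ch.
apply: (measurability _ (RGenOpens.measurableE R)) => //.
move=> _ [_ [a [b ->] <-]]; rewrite setTI.
by apply: sub_sigma_algebra; apply: ch; exact: interval_open.
Qed.

Lemma integral_push01 (c : R -> V) (h : V -> R) :
  measurable_fun (setT : set (measurableTypeR R)) (c : R -> borel V) ->
  continuous h -> (exists M, forall y, `|h y| <= M) ->
  (\int[push01 c]_(y in [set: borel V]) (h y)%:E)%E =
  (\int[leb01]_t h (c t))%:E.
Proof.
move=> mc ch [M hM].
have mh := continuous_borel_measurable ch.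
have int_hc : leb01.-integrable setT (EFin \o (h \o c)).
  by apply: leb01_integrable; [exact: (measurableT_comp mh mc)|exists M => t; exact: hM].
rewrite /Rintegral fineK; last exact: integrable_fin_num int_hc.
have -> : push01 c = pushforward leb01 (c : R -> borel V) by [].
rewrite (integral_pushforward mc) //.
exact/measurable_EFinP.
Qed.

Lemma measurable_comp_clamp01 (U : normedModType R) (q : R -> U) :
  measurable_fun (setT : set (measurableTypeR R)) (q : R -> borel U) ->
  measurable_fun (setT : set (measurableTypeR R))
    (q \o clamp01 : R -> borel U).
Proof. by move=> mq; exact: (measurableT_comp mq measurable_clamp01). Qed.

(** A bounded continuous [h] integrates to [h D] against the point mass and has finite integral
    against each [push01 (q k)], so convergence in the extended reals becomes convergence of real
    integrals over the probability measure [leb01]. *)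
Lemma weak_star_cvg_diracP (q : nat -> R -> V) (D : V) :
  (forall k, measurable_fun (setT : set (measurableTypeR R))
    (q k : R -> borel V)) ->
  weak_star_cvg (fun k => push01 (q k)) (dirac (D : borel V)) <->
  forall h : V -> R, continuous h -> (exists M, forall y, `|h y| <= M) ->
    \int[leb01]_t h (q k (clamp01 t)) @[k --> \oo] --> h D.
Proof.
move=> mq; have mqc k := measurable_comp_clamp01 (mq k).
have step (h : V -> R) : continuous h -> (exists M, forall y, `|h y| <= M) ->
    (\int[push01 (q k)]_(y in [set: borel V]) (h y)%:E @[k --> \oo] -->
     \int[\d_(D : borel V)]_(y in [set: borel V]) (h y)%:E)%E <->
    \int[leb01]_t h (q k (clamp01 t)) @[k --> \oo] --> h D.
  move=> ch bh; have mh : measurable_fun [set: borel V] (fun y => (h y)%:E).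
    by apply/measurable_EFinP; exact: continuous_borel_measurable ch.
  rewrite (integral_dirac _ measurableT mh) diracT mul1e.
  under eq_fun do rewrite push01_clamp integral_push01 //.
  by split=> [/fine_cvg //|hD]; apply: cvg_EFin => //; exact: nearW.
by split=> H h ch bh; apply/step => //; exact: H.
Qed.

End Push.

Arguments leb01 {R}.

(** * Limits under a uniformly continuous map and a uniformly small perturbation *)

Section Perturbation.
Variables (R : realType) (V W : normedModType R) (L : V -> W) (A : set R).
Variables (s : nat -> R -> V) (c : nat -> R -> W).
Hypothesis L_ucont : forall eps : R, 0 < eps ->
  exists2 del : R, 0 < del & forall u v, `|u - v| < del -> `|L u - L v| < eps.

(** Both sets are images of the same parameter set, so a time [t] matching [z] for [s k] also
    matches [L z] for [c k]: one [eps / 2] is spent on the perturbation, the other on [L]. *)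
Lemma hausdorff_cvg_perturb (X : set V) :
  (forall eps : R, 0 < eps ->
    \forall k \near \oo, forall t, A t -> `|c k t - L (s k t)| < eps) ->
  hausdorff_cvg (fun k => s k @` A) X ->
  hausdorff_cvg (fun k => c k @` A) (L @` X).
Proof.
move=> close cvs eps eps0; have eps20 : 0 < eps / 2 by rewrite divr_gt0.
have [del del0 Ldel] := L_ucont eps20.
near=> k; have close_k : forall t, A t -> `|c k t - L (s k t)| < eps / 2.
  by near: k; exact: close.
have [sX Xs] : (forall y, (s k @` A) y -> exists2 z, X z & `|y - z| < del) /\
    (forall z, X z -> exists2 y, (s k @` A) y & `|y - z| < del).
  by near: k; exact: cvs.
have tri t z : A t -> `|s k t - z| < del -> `|c k t - L z| < eps.
  move=> At /Ldel sz; rewrite (splitr eps) -(subrKA (L (s k t))).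
  exact: le_lt_trans (ler_normD _ _) (ltrD (close_k t At) sz).
split=> [_ [t At <-]|_ [z Xz <-]].
  have [z Xz sz] := sX _ (imageP _ At).
  by exists (L z); [exact: imageP|exact: tri].
have [_ [t At <-] sz] := Xs _ Xz.
by exists (c k t); [exact: imageP|exact: tri].
Unshelve. all: by end_near. Qed.

Lemma weak_star_cvg_dirac_perturb (D : V) :
  (forall k, measurable_fun (setT : set (measurableTypeR R))
    (s k : R -> borel V)) ->
  (forall k, measurable_fun (setT : set (measurableTypeR R))
    (c k : R -> borel W)) ->
  (forall eps : R, 0 < eps -> \forall k \near \oo,
    forall t, `[0, 1]%classic t -> `|c k t - L (s k t)| < eps) ->
  weak_star_cvg (fun k => push01 (s k)) (dirac (D : borel V)) ->
  weak_star_cvg (fun k => push01 (c k)) (dirac (L D : borel W)).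
Proof.
move=> ms mc close /(weak_star_cvg_diracP D ms) cvs.
apply/weak_star_cvg_diracP => // h ch bh.
(* The bound is made positive because [eta] below divides by it. *)
have [M M_gt0 hM] : exists2 M, 0 < M & forall y, `|h y| <= M.
  case: bh => M0 hM0; exists (M0 + 1) => [|y].
    by rewrite ltr_wpDl // (le_trans _ (hM0 0)).
  by rewrite (le_trans (hM0 y)) // lerDl.
have cL : continuous L.
  move=> y; apply/cvgrPdist_lt => eps /L_ucont[del del0 Ldel].
  by near=> z; apply: Ldel; near: z; exact: cvgr_dist_lt.
apply/cvgrPdist_lt => eps eps0.
have /cvgrPdist_lt/(_ (eps / 3)) : h y @[y --> L D] --> h (L D) by exact: ch.
rewrite divr_gt0 // => /(_ isT) /nbhs_ballP[del /= del0 hdel].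
(* The test function [phi] vanishes at [D] and bounds the indicator of
   [|L D - L y| >= del], so weak-* convergence bounds the mass away from [L D];
   near [L D], [h] is almost constant. *)
pose phi y := Num.min 1 (`|L D - L y| / del).
have phi_ge0 y : 0 <= phi y.
  by rewrite /phi le_min ler01 divr_ge0 // ltW.
have phi_le1 y : `|phi y| <= 1 by rewrite ger0_norm // /phi ge_min lexx.
have cphi : continuous phi.
  apply: min_fun_continuous; first by move=> y; exact: cvg_cst.
  move=> y; apply: cvgMl; apply: cvg_norm; apply: cvgB; last exact: cL.
  exact: cvg_cst.
(* Chosen so that [2 * M * eta = eps / 3]: the oscillation of [h] near [L D], the perturbation and
   the integral of [phi] each cost at most a third of [eps], the last one strictly less. *)
pose eta := eps / (6 * M).
have eta0 : 0 < eta by rewrite divr_gt0 // mulr_gt0.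
have := cvs _ cphi (ex_intro _ 1 phi_le1).
rewrite {2}/phi subrr normr0 mul0r min_r // => /cvgrPdist_lt/(_ _ eta0) cvphi.
near=> k.
have int_phi : \int[leb01]_t phi (s k (clamp01 t)) < eta.
  apply: le_lt_trans (ler_norm _) _; rewrite -normrN -sub0r.
  by near: k; exact: cvphi.
(* Dividing distances by [del], as [phi] does, turns this tolerance into [eta]. *)
have close_k t : `[0, 1]%classic t -> `|c k t - L (s k t)| < del * eta.
  by move: t; near: k; apply: close; rewrite mulr_gt0.
have int_comp (U : normedModType R) (q : R -> U) (g : U -> R) :
    measurable_fun (setT : set (measurableTypeR R)) (q : R -> borel U) ->
    continuous g -> (exists N, forall y, `|g y| <= N) ->
    leb01.-integrable setT (EFin \o (fun t => g (q (clamp01 t)))).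
  move=> mq cg [N gN]; apply: leb01_integrable; last by exists N => t; exact: gN.
  exact: (measurableT_comp (continuous_borel_measurable cg)
    (measurable_comp_clamp01 mq)).
have int_cst r : leb01.-integrable setT (EFin \o (fun _ : R => r)).
  by apply: leb01_integrable => //; exists `|r|.
have int_hc := int_comp _ _ _ (mc k) ch bh.
have int_phis := int_comp _ _ _ (ms k) cphi (ex_intro _ 1 phi_le1).
have Rint_cst r : \int[@leb01 R]_t r = r.
  by rewrite Rintegral_cst // leb01T mulr1.
pose g y := h (L D) - h y.
have cg : continuous g by move=> y; apply: cvgB; [exact: cvg_cst|exact: ch].
have hg y : `|g y| <= 2 * M.
  by rewrite (le_trans (ler_normB _ _)) // mulr_natl mulr2n lerD.
have int_g : leb01.-integrable setT (EFin \o (fun t => g (c k (clamp01 t)))).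
  by apply: int_comp => //; exists (2 * M).
have int_ng : leb01.-integrable setT (EFin \o (fun t => `|g (c k (clamp01 t))|)).
  apply: (int_comp _ _ (fun y => `|g y|)) => //.
    by move=> y; apply: cvg_norm; exact: cg.
  by exists (2 * M) => y; rewrite normr_id.
have int_Mphi : leb01.-integrable setT
    (EFin \o (fun t => 2 * M * phi (s k (clamp01 t)))).
  apply: (int_comp _ _ (fun y => 2 * M * phi y)) => //.
    by move=> y; apply: cvgMr; exact: cphi.
  exists (2 * M) => y; rewrite normrM ger0_norm ?ler_piMr ?mulr_ge0 //;
    exact: ltW.
have Meta : 2 * M * eta = eps / 3 by rewrite /eta; field; rewrite gt_eqF.
(* If [c k u] is within [del] of [L D], the first term suffices. Otherwise [1 <= eta + phi (s k u)]
   by the triangle inequality, and the crude bound [2 * M] on [g] is absorbed by the rest. *)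
have pw t : `|g (c k (clamp01 t))| <=
    eps / 3 + (2 * M * eta + 2 * M * phi (s k (clamp01 t))).
  set u := clamp01 t; have [cD|cD] := ltrP `|L D - c k u| del.
    have /ltW hD : `|g (c k u)| < eps / 3 by apply: hdel; rewrite -ball_normE.
    apply: le_trans hD _.
    by rewrite lerDl -mulrDr !mulr_ge0 ?addr_ge0 // ltW.
  apply: le_trans (hg _) _; rewrite -mulrDr ler_wpDl ?divr_ge0 ?(ltW eps0) //.
  rewrite ler_peMr ?mulr_ge0 ?(ltW M_gt0) // -lerBlDl le_min gerBl ltW //=.
  rewrite ler_pdivlMr // mulrBl mul1r lerBlDr (le_trans cD) //.
  rewrite -(subrKA (L (s k u))) (le_trans (ler_normD _ _)) // lerD2l.
  rewrite distrC mulrC ltW // close_k //= in_itv /=; exact: clamp01_itv.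
(* As [leb01] has mass 1, [h (L D)] is the integral of a constant, and the difference becomes the
   integral of [g]. *)
rewrite -[X in X - _]Rint_cst -RintegralB //.
apply: le_lt_trans (le_normr_Rintegral _ _) _ => //.
have int_Meta_phi : leb01.-integrable setT
    (EFin \o (fun t => 2 * M * eta + 2 * M * phi (s k (clamp01 t)))).
  exact: (integrableD measurableT (int_cst _) int_Mphi).
apply: le_lt_trans (le_Rintegral measurableT int_ng
  (integrableD measurableT (int_cst _) int_Meta_phi) (fun t _ => pw t)) _.
rewrite !RintegralD // !Rint_cst RintegralZl // Meta.
have : 2 * M * (\int[leb01]_t phi (s k (clamp01 t))) < 2 * M * eta.
  by rewrite ltr_pM2l // mulr_gt0.
rewrite Meta; lra.
Unshelve. all: by end_near. Qed.

End Perturbation.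

(** * Word paths as loops, and the homology classes of prefixes *)

Lemma within_continuous_comp (X Y Z : topologicalType) (A : set X) (B : set Y)
    (u : X -> Y) (h : Y -> Z) :
  continuous u -> (forall x, A x -> B (u x)) ->
  {within B, continuous h} -> {within A, continuous (h \o u)}.
Proof.
move=> cu AB /subspace_continuousP ch; apply/subspace_continuousP => x Ax.
move=> N /(ch _ (AB _ Ax)) hN.
have {hN} : nbhs x (u @^-1` [set y | B y -> N (h y)]) by exact: cu.
by apply: filterS => y yN /AB; exact: yN.
Qed.

Lemma itv01_half (R : realType) :
  `[0, 1]%classic = `[0, 2^-1] `|` `[2^-1, 1] :> set R.
Proof.
apply/seteqP; split => t /=; rewrite !in_itv /=.
  by case: (lerP t 2^-1) => ? /andP[? ?]; [left|right]; apply/andP; split; lra.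
by case=> /andP[? ?]; apply/andP; split; lra.
Qed.

Section Paths.
Variables (R : realType) (T : topologicalType).
Implicit Types (gam del : R -> T) (p : T).

Lemma concat_path_continuous gam del :
  {within `[0, 1]%classic, continuous gam} ->
  {within `[0, 1]%classic, continuous del} -> gam 1 = del 0 ->
  {within `[0, 1]%classic, continuous (concat_path gam del)}.
Proof.
move=> cg cd gd.
rewrite itv01_half; apply: withinU_continuous; [exact: itv_closed|exact: itv_closed| |].
  apply: (@subspace_eq_continuous _ _ _ (gam \o (fun t => 2 * t))).
    by move=> t; rewrite inE /= in_itv /= => /andP[_ t2]; rewrite /from_subspace /concat_path t2.
  apply: within_continuous_comp cg; first exact: mulrl_continuous.
  by move=> t /=; rewrite !in_itv /= => /andP[]; clear => ? ?; apply/andP; split; lra.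
apply: (@subspace_eq_continuous _ _ _ (del \o (fun t => 2 * t - 1))).
  move=> t; rewrite inE /= in_itv /= => /andP[t2 _]; rewrite /from_subspace /concat_path.
  (* The closed halves overlap only at 1/2, where the definition takes the [gam] branch; there the
     values agree since [gam 1 = del 0]. *)
  case: ifPn => // t2'; have -> : t = 2^-1 by apply/eqP; rewrite eq_le t2' t2.
  by rewrite mulfV ?pnatr_eq0 // subrr.
apply: within_continuous_comp cd.
  by move=> t; apply: cvgB; [exact: mulrl_continuous|exact: cvg_cst].
by move=> t /=; rewrite !in_itv /= => /andP[]; clear => ? ?; apply/andP; split; lra.
Qed.

Lemma concat_path_loop p gam del :
  loop_at p gam -> loop_at p del -> loop_at p (concat_path gam del).
Proof.
move=> [cg g0 g1] [cd d0 d1]; split.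
- by apply: concat_path_continuous => //; rewrite g1 d0.
- by rewrite /concat_path invr_ge0 ler0n mulr0.
- rewrite /concat_path; case: ifPn => [h|_]; first by exfalso; move: h; clear; lra.
  by rewrite mulr1 (_ : 2 - 1 = 1) //; clear; lra.
Qed.

Lemma rev_path_loop p gam : loop_at p gam -> loop_at p (rev_path gam).
Proof.
move=> [cg g0 g1]; split; rewrite /rev_path ?subr0 ?subrr //.
apply: (@within_continuous_comp R R T _ `[0, 1]%classic (fun t => 1 - t) gam _ _ cg).
  by move=> t; apply: cvgB; [exact: cvg_cst|exact: cvg_id].
by move=> t /=; rewrite !in_itv /= => /andP[]; clear => ? ?; apply/andP; split; lra.
Qed.

Lemma word_path_loop n p (a : 'I_n -> R -> T) (w : seq (letter n)) :
  (forall j, loop_at p (a j)) -> loop_at p (word_path p a w).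
Proof.
move=> la; elim: w => [|[j b] w IHw] /=.
  by split => //; apply: continuous_subspaceT => t; exact: cvg_cst.
apply: concat_path_loop => //; case: b => //=; exact: rev_path_loop.
Qed.

Lemma freely_homotopic_refl gam : closed_curve gam -> freely_homotopic gam gam.
Proof.
move=> [cg g01]; exists (gam \o snd); split=> //.
apply: within_continuous_comp cg; first by move=> z; exact: cvg_snd.
by move=> z [].
Qed.

Lemma homology_class_word_path n p (a : 'I_n -> R -> T) (w : seq (letter n)) :
  (forall j, loop_at p (a j)) -> reduced w ->
  homology_class p a (word_path p a w) (abel R w).
Proof.
move=> la rw; exists (exist (fun v : seq (letter n) => reduced v) w rw).
split=> //; apply: freely_homotopic_refl.
by have [cw w0 w1] := word_path_loop w la; split; rewrite ?w0 ?w1.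
Qed.

Lemma prefix_intE n (O : set (chart R T)) p (a : 'I_n -> R -> T) (J : 'M[R]_n)
    f x delta dhat i t :
  free_basis_pi1 p a -> represents_alg_int O p a J ->
  homology_class p a delta dhat ->
  let w := val (iter i f x) in
  prefix_int O p a f x delta i t =
  bilin J (abel R (take (Num.truncn ((size w)%:R * t)) w)) dhat.
Proof.
move=> [la _] rJ hd w; rewrite /prefix_int; apply: rJ hd.
(* Being reduced is a [sorted] condition on adjacent letters, hence passes to prefixes. *)
apply: homology_class_word_path => //; apply: take_sorted.
exact: (valP (iter i f x)).
Qed.

End Paths.

(** * The functional [bilin J - d] on prefixes and shadow paths *)

Section Bilin.
Variables (R : realType) (n : nat) (J : 'M[R]_n) (d : 'rV[R]_n).

Lemma bilinDl u v : bilin J (u + v) d = bilin J u d + bilin J v d.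
Proof. by rewrite /bilin !mulmxDl mxE. Qed.

Lemma bilinZl c u : bilin J (c *: u) d = c * bilin J u d.
Proof. by rewrite /bilin -!scalemxAl mxE. Qed.

Lemma bilin0l : bilin J 0 d = 0.
Proof. by rewrite /bilin !mul0mx mxE. Qed.

Lemma bilinBl u v : bilin J (u - v) d = bilin J u d - bilin J v d.
Proof. by rewrite -(scaleN1r v) bilinDl bilinZl mulN1r. Qed.

(** The operator norm of [bilin J - d] for the sup norm carried by row vectors. *)
Definition bilin_bound : R := \sum_j `|bilin J (delta_mx 0 j) d|.

Lemma bilin_bound_ge0 : 0 <= bilin_bound.
Proof. exact: sumr_ge0. Qed.

Lemma normr_bilin u : `|bilin J u d| <= bilin_bound * `|u|.
Proof.
rewrite {1}(row_sum_delta u) (big_morph _ bilinDl bilin0l).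
rewrite mulr_suml; apply: le_trans (ler_norm_sum _ _ _) _; apply: ler_sum => j _.
rewrite bilinZl normrM mulrC ler_wpM2l //.
rewrite [leRHS]/Num.Def.normr /= mx_normrE.
by apply/bigmax_geP; right => /=; exists (0, j).
Qed.

(** The abelianisation of one letter is a signed basis vector. The empty case occurs at the end of a
    word, where no next letter exists. *)
Lemma normr_bilin_letter (w : seq (letter n)) :
  `|bilin J (abel R (take 1 w)) d| <= bilin_bound.
Proof.
case: w => [|[j b] w] /=; rewrite /abel.
  by rewrite big_nil bilin0l normr0 bilin_bound_ge0.
rewrite take0 big_seq1 bilinZl normrM normrX normrN1 expr1n mul1r /=.
by rewrite /bilin_bound (bigD1 j) //= lerDl sumr_ge0.
Qed.

Lemma bilin_prefix_shadow (k : nat) (w : seq (letter n)) (t : R) : 0 <= t ->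
  `|k%:R^-1 * bilin J (abel R (take (Num.truncn ((size w)%:R * t)) w)) d
    - bilin J (shadow_path_at k w t) d| <= k%:R^-1 * bilin_bound.
Proof.
move=> t0; rewrite /shadow_path_at /shadow_path bilinZl bilinDl bilinZl.
set s := (size w)%:R * t.
have /truncn_itv/andP[ms sm] : 0 <= s by rewrite mulr_ge0.
(* The prefix terms cancel, leaving the fractional part of [s], at most 1, times the value on the
   next letter. *)
rewrite -mulrBr opprD addrA subrr sub0r normrM normrN normrM.
rewrite ger0_norm ?invr_ge0 // ler_wpM2l ?invr_ge0 //.
rewrite -[leRHS]mul1r ler_pM //; last exact: normr_bilin_letter.
rewrite ger0_norm ?subr_ge0 // lerBlDl; move: sm; rewrite -natr1 => /ltW.
by rewrite addrC.
Qed.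

Lemma bilin_unif_continuous (eps : R) : 0 < eps ->
  exists2 del : R, 0 < del &
    forall u v, `|u - v| < del -> `|bilin J u d - bilin J v d| < eps.
Proof.
(* Adding 1 keeps the denominator of the modulus positive even if the functional vanishes. *)
move=> eps0; have B1 : 0 < bilin_bound + 1 by rewrite ltr_wpDl ?bilin_bound_ge0.
exists (eps / (bilin_bound + 1)) => [|u v]; first by rewrite divr_gt0.
rewrite ltr_pdivlMr // -bilinBl; apply: le_lt_trans.
by rewrite (le_trans (normr_bilin _)) // mulrC ler_wpM2l // lerDl.
Qed.

Lemma near_bilin_prefix_shadow (w : nat -> seq (letter n)) (eps : R) :
  0 < eps ->
  \forall k \near \oo, forall t, `[0, 1]%classic t ->
    `|k%:R^-1 * bilin J (abel R
          (take (Num.truncn ((size (w k))%:R * t)) (w k))) d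
      - bilin J (shadow_path_at k (w k) t) d| < eps.
Proof.
move=> eps0; near=> k => t; rewrite /= in_itv /= => /andP[t0 _].
apply: le_lt_trans (bilin_prefix_shadow _ _ t0) _.
(* This threshold depends on neither [t] nor the words, which makes the estimate uniform; it also
   forces [k] to be positive. *)
have kB : bilin_bound / eps < k%:R by near: k; exact: nbhs_infty_gtr.
have k0 : 0 < k%:R :> R.
  by apply: le_lt_trans kB; rewrite divr_ge0 ?bilin_bound_ge0 // ltW.
by rewrite mulrC ltr_pdivrMr // mulrC -ltr_pdivrMr.
Unshelve. all: by end_near. Qed.

End Bilin.

(** * Measurability of shadow paths and the two limits *)

Lemma measurable_shadow_path (R : realType) n (k : nat) (w : seq (letter n)) :
  measurable_fun (setT : set (measurableTypeR R))
    (shadow_path_at k w : R -> borel 'rV[R]_n).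
Proof.
pose G m (t : R) : 'rV[R]_n := k%:R^-1 *: (abel R (take m w) +
  ((size w)%:R * t - m%:R) *: abel R (take 1 (drop m w))).
apply: (borel_measurable_piecewise
  (idx := fun t => Num.truncn ((size w)%:R * t)) (G := G)).
  by move=> m; exact: measurable_fiber_truncn.
move=> m t; apply: cvgZr; apply: cvgD; first exact: cvg_cst.
by apply: cvgZl; apply: cvgB; [exact: mulrl_continuous|exact: cvg_cst].
Qed.


Theorem corollary1p4 (R : realType) (T : topologicalType) (g : nat)
    (O : set (chart R T)) (p : T) (a : 'I_(2 * g) -> R -> T)
    (J : 'M[R]_(2 * g)) (phi : T -> T)
    (f : free_group (2 * g) -> free_group (2 * g))
    (Sinf : set 'rV[R]_(2 * g)) (Dinf : 'rV[R]_(2 * g))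
    (x : free_group (2 * g)) (delta : R -> T) (dhat : 'rV[R]_(2 * g)) :
  compact_surface_g1 R T g -> oriented_atlas O -> surf_bd R T p ->
  free_basis_pi1 p a ->
  symplectic J -> represents_alg_int O p a J ->
  mod_homeo O phi -> pseudo_anosov R phi ->
  induces_on_pi1 p a phi f -> fully_irreducible f -> finite_order_ab f ->
  is_limit_shadow f Sinf -> is_limit_mean f Dinf ->
  infinite_orbit f x ->
  simple_closed_curve delta -> nonperipheral delta ->
  homology_class p a delta dhat ->
  hausdorff_cvg
    (fun i : nat =>
       (fun t : R => i%:R^-1 * prefix_int O p a f x delta i t)
         @` `[0, 1]%classic : set R^o)
    ((fun y => bilin J y dhat) @` Sinf) /\
  weak_star_cvg
    (fun i : nat =>
       push01 (fun t : R =>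
         i%:R^-1 * prefix_int O p a f x delta i t : R^o))
    (dirac (bilin J Dinf dhat : borel R^o)).
Proof.
move=> _ _ _ basis_a _ repJ _ _ _ _ _ [_ shadow_cvg] mean_cvg orb_x _ _ hd.
pose L y : R^o := bilin J y dhat.
pose s k := shadow_path_at k (val (iter k f x)) : R -> 'rV[R]_(2 * g).
pose c (k : nat) (t : R) : R^o := k%:R^-1 * prefix_int O p a f x delta k t.
have close (eps : R) : 0 < eps ->
    \forall k \near \oo, forall t, `[0, 1]%classic t -> `|c k t - L (s k t)| < eps.
  move=> /(near_bilin_prefix_shadow J dhat (fun k => val (iter k f x))).
  apply: filterS => k H t t01.
  by rewrite /c (prefix_intE f x k t basis_a repJ hd) H.
have ucont := @bilin_unif_continuous R _ J dhat.
split.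
  exact: (hausdorff_cvg_perturb (L := L) (s := s) (c := c) ucont close
    (shadow_cvg _ orb_x)).
apply: (weak_star_cvg_dirac_perturb (L := L) (s := s) (c := c) ucont
  _ _ close (mean_cvg _ orb_x)) => k; first exact: measurable_shadow_path.
pose w := val (iter k f x).
(* On a fibre of [truncn] the prefix is fixed, so [c k] is a step function with these values. *)
pose G m (_ : R) : R^o := k%:R^-1 * bilin J (abel R (take m w)) dhat.
have -> : c k = fun t => G (Num.truncn ((size w)%:R * t)) t.
  by apply/funext => t; rewrite /c (prefix_intE f x k t basis_a repJ hd).
apply: borel_measurable_piecewise => m; last by move=> t; exact: cvg_cst.
exact: measurable_fiber_truncn.
Qed.
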